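(* There exists a metric $d$ on $\mathbb{R}$, compatible with the usual topology (i.e. inducing the usual topology of $\mathbb{R}$), such that the multiplication map $m:\mathbb{R}\times\mathbb{R}\to\mathbb{R}$ given by $m(x,y)=xy$ is open but not uniformly open, where $\mathbb{R}$ is equipped with the metric $d$ and $\mathbb{R}\times\mathbb{R}$ with the corresponding maximum metric.
   Context: A function $f:X\to Y$ between metric spaces is uniformly open if for every $\varepsilon>0$ there exists $\delta>0$ such that for every $x\in X$, $B_Y(f(x),\delta)\subseteq f(B_X(x,\varepsilon))$, where $B_X(x,\varepsilon)$ and $B_Y(y,\delta)$ denote open balls. A map is open if it sends open sets to open sets. The maximum metric on a product $X\times Y$ of metric spaces $(X,d_X)$, $(Y,d_Y)$ is $\max\{d_X(x,s),d_Y(y,t)\}$ for points $(x,y),(s,t)\in X\times Y$. *)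

(* Defs.v *)
From HB Require Import structures.
From mathcomp Require Import all_boot all_order all_algebra.
From mathcomp Require Import all_classical all_reals all_analysis.

Set Implicit Arguments.
Unset Strict Implicit.
Unset Printing Implicit Defensive.

Import Order.TTheory GRing.Theory Num.Theory.
Import numFieldNormedType.Exports.

Local Open Scope classical_set_scope.
Local Open Scope ring_scope.

(* A metric as a first-class object, so that it can be quantified over; the
   fields are those of the library's factory [isMetric] (nonnegativity follows
   from them). *)
Record metric (K : numFieldType) (T : Type) := Metric {
  metric_dist :> T -> T -> K ;
  metric_distxx : forall x, metric_dist x x = 0 ;
  metric_dist_eq0 : forall x y, metric_dist x y = 0 -> x = y ;
  metric_distC : forall x y, metric_dist x y = metric_dist y x ;
  metric_dist_triangle : forall y x z,
    metric_dist x z <= metric_dist x y + metric_dist y z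
}.

(* The set [T] with the metric-space structure given by [d]; this alias hides
   any topology that [T] itself may carry. *)
Definition metrized (K : numFieldType) (T : choiceType) (d : metric K T) : Type
  := T.

HB.instance Definition _ (K : numFieldType) (T : choiceType) (d : metric K T) :=
  Choice.copy (metrized d) T.
HB.instance Definition _ (K : numFieldType) (T : choiceType) (d : metric K T) :=
  isMetric.Build K (metrized d) (metric_distxx d) (@metric_dist_eq0 _ _ d)
    (metric_distC d) (metric_dist_triangle d).

(* The library equips a product of (pseudo)metric spaces with the products of
   balls of equal radii; these are the balls of the maximum metric. *)
Section max_metric.
Context {K : realFieldType} {X Y : metricType K}.
Implicit Types p q : X * Y.

Definition max_dist p q : K := Num.max (mdist p.1 q.1) (mdist p.2 q.2).

Let max_dist_ge0 p q : 0 <= max_dist p q.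
Proof. by rewrite le_max mdist_ge0. Qed.

Let max_dist_positivity p q : max_dist p q = 0 -> p = q.
Proof.
move=> pq0; have : max_dist p q <= 0 by rewrite pq0.
rewrite ge_max => /andP[le1 le2]; rewrite [p]surjective_pairing.
rewrite [q]surjective_pairing; congr pair.
  by apply/mdist_positivity/le_anti; rewrite le1 mdist_ge0.
by apply/mdist_positivity/le_anti; rewrite le2 mdist_ge0.
Qed.

Let ball_max_dist p e : ball p e = [set q | max_dist p q < e].
Proof.
apply/seteqP; split=> q; rewrite /ball /= /prod_ball /max_dist gt_max !ballEmdist /=.
  by move=> [-> ->].
by move=> /andP[].
Qed.

HB.instance Definition _ := @PseudoMetric_isMetric.Build K (X * Y)%type
  max_dist max_dist_ge0 max_dist_positivity ball_max_dist.

End max_metric.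

Definition open_map (X Y : topologicalType) (f : X -> Y) : Prop :=
  forall U : set X, open U -> open (f @` U).

Definition uniformly_open (K : realFieldType) (X Y : metricType K) (f : X -> Y) :
    Prop :=
  forall eps : K, 0 < eps -> exists2 delta : K, 0 < delta &
    forall x : X, ball (f x) delta `<=` f @` ball x eps.

Definition compatible (K : numFieldType) (T : topologicalType) (d : metric K T) :
    Prop :=
  forall A : set T, @open (metrized d) A <-> @open T A.

Definition mulmap (R : realType) (d : metric R R) :
    metrized d * metrized d -> metrized d :=
  fun p => (p.1 : R) * (p.2 : R).
Arguments mulmap {R} d p.

(* Main.v *)
Require Import Defs.
From mathcomp Require Import all_boot all_order all_algebra.
From mathcomp Require Import all_classical all_reals all_analysis.
From mathcomp Require Import lra.
Import Order.TTheory GRing.Theory Num.Theory.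
Import numFieldNormedType.Exports.

Local Open Scope classical_set_scope.
Local Open Scope ring_scope.

(** Pull back the usual metric along the homeomorphism [x |-> exp (- x)] from
    the line onto the positive half-line.  Openness of a map is a topological
    property, so multiplication stays open.  For large [N] the unit ball around
    [- N] lies in [(- N - 1, 0)], so products of two of its points are below
    [(N + 1)^2]; yet [(N + 1)^2] is arbitrarily close to [(- N) * (- N)], since
    the new metric collapses at [+oo]. *)

Section exp_metric.
Context {R : realType}.

Definition exp_dist (x y : R) : R := `|expR (- x) - expR (- y)|.

Fact exp_distxx (x : R) : exp_dist x x = 0.
Proof. by rewrite /exp_dist subrr normr0. Qed.

Fact exp_dist_eq0 (x y : R) : exp_dist x y = 0 -> x = y.
Proof.
by move=> /normr0P; rewrite subr_eq0 => /eqP /expR_inj /oppr_inj.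
Qed.

Fact exp_distC (x y : R) : exp_dist x y = exp_dist y x.
Proof. exact: distrC. Qed.

Fact exp_dist_triangle (y x z : R) :
  exp_dist x z <= exp_dist x y + exp_dist y z.
Proof. exact: ler_distD. Qed.

Definition exp_metric : metric R R :=
  Defs.Metric exp_distxx exp_dist_eq0 exp_distC exp_dist_triangle.

(** Each inclusion is a continuity: that of [expR (- t)] at [x], and that of its inverse [- ln u] at
    [expR (- x)]. *)
Lemma nbhs_exp_metric (x : R) (A : set R) :
  @nbhs _ (metrized exp_metric) x A <-> @nbhs _ R x A.
Proof.
split.
  move=> /nbhs_ballP[e /= e0 eA].
  have expN : (fun t : R => expR (- t)) @ x --> expR (- x).
    by apply: continuous_comp; [exact: opp_continuous | exact: continuous_expR].
  move/cvgrPdist_lt : expN => /(_ _ e0); apply: filterS => t xt.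
  by apply: eA; rewrite ballEmdist.
move=> xA; have : (fun u : R => - ln u) @ expR (- x) --> x.
  rewrite -[X in _ --> X]opprK -[X in _ --> - X]expRK.
  by apply: cvgN; exact/continuous_ln/expR_gt0.
move=> /(_ _ xA) /nbhs_ballP[e /= e0 eA].
apply/nbhs_ballP; exists e => // t; rewrite ballEmdist => /eA /=.
by rewrite expRK opprK.
Qed.

Lemma compatible_exp_metric : compatible exp_metric.
Proof.
move=> A; rewrite !openE; split=> oA x Ax; apply/nbhs_exp_metric; exact: oA.
Qed.

End exp_metric.

Section compatible_metric.
Context {R : realType} (d : metric R R) (dR : compatible d).

Lemma compatible_nbhs (x : R) (A : set R) :
  @nbhs _ (metrized d) x A <-> @nbhs _ R x A.
Proof.
by rewrite !nbhsE; split=> -[B [oB Bx] BA]; exists B => //; split=> //; exact/dR.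
Qed.

(** The image of [B] contains its preimage under division by [x], which is continuous. *)
Lemma nbhs_mulr_image (x y : R) (B : set R) : x != 0 -> nbhs y B ->
  nbhs (x * y) [set x * t | t in B].
Proof.
move=> x0 yB; have : (fun z : R => x^-1 * z) @ (x * y) --> y.
  by rewrite -[X in _ --> X](mulKf x0); apply: cvgMr; exact: cvg_id.
move=> /(_ _ yB) zB; apply: (@filterS _ (nbhs (x * y)) _ _ _ _ zB) => z Bz.
by exists (x^-1 * z) => //; rewrite mulVKf.
Qed.

(** Holding one nonzero factor fixed and varying the other already fills a neighbourhood of the
    product; only the origin offers no such factor. *)
Lemma open_map_mulmap : open_map (mulmap d).
Proof.
move=> U oU; apply/dR; rewrite openE => _ [[x y] Uxy <-].
have [[A B] /= [/compatible_nbhs xA /compatible_nbhs yB] ABU] :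
  nbhs (x, y) U by exact: open_nbhs_nbhs.
have Ax : A x by apply: (@nbhs_singleton R x).
have By : B y by apply: (@nbhs_singleton R y).
(* A general [s] in [A], not just [x], so that the origin can use it too. *)
have image_right s : s != 0 -> A s -> nbhs (s * y) (mulmap d @` U).
  move=> s0 As; apply: filterS (nbhs_mulr_image s y B s0 yB) => _ [t Bt <-].
  by exists (s, t) => //; exact: ABU.
rewrite /interior /mulmap /=.
have [x0|x0] := eqVneq (x : R) 0; last exact: image_right.
have [y0|y0] := eqVneq (y : R) 0; last first.
  rewrite mulrC; apply: filterS (nbhs_mulr_image y x A y0 xA) => _ [s As <-].
  by exists (s, y); [exact: ABU | exact: mulrC].
(* At the origin, move to a point [(s, 0)] of [U] with the same product. *)
have [e /= e0 eA] := (nbhs_ballP _ _).1 xA.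
have /image_right : e / 2 != 0 by rewrite gt_eqF// divr_gt0.
rewrite x0 y0 !mulr0; apply; apply: eA; rewrite /ball /= x0 sub0r normrN.
by rewrite gtr0_norm ?divr_gt0//; lra.
Qed.

End compatible_metric.

(** Since [expR N] and [expR 1] are at least 2, [expR (- s) < expR N + 1 <= expR (N + 1)]; and
    [expR (- s) > expR N - 1 >= N >= 1]. *)
Lemma exp_ball_bounds {R : realType} (N s : R) : 1 <= N ->
  exp_dist (- N) s < 1 -> - (N + 1) < s < 0.
Proof.
move=> N1; rewrite /exp_dist opprK ltr_distlC => /andP[sl su].
have eN := expR_ge1Dx N; have e1 := expR_ge1Dx (1 : R).
apply/andP; split.
  rewrite -ltrN2 opprK -ltr_expR expRD (lt_le_trans su)//.
  nra.
by rewrite -oppr_gt0 -ltr_expR expR0; lra.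
Qed.

Lemma not_uniformly_open_exp_metric {R : realType} :
  ~ uniformly_open (mulmap (@exp_metric R)).
Proof.
move=> /(_ 1 ltr01)[e e0 /=].
(* This makes [expR (N * N) >= 1 + N * N > e^-1]. *)
pose N : R := 1 + e^-1.
have N1 : 1 <= N by rewrite lerDl invr_ge0 ltW.
move=> /(_ (- N, - N) ((N + 1) ^+ 2)) [].
  rewrite ballEmdist /= /mdist /= /exp_dist /mulmap /= mulrNN.
  have NN : expR (- (N + 1) ^+ 2) <= expR (- (N * N)) by rewrite ler_expR; nra.
  rewrite ger0_norm ?subr_ge0//.
  have pos := expR_gt0 (- (N + 1) ^+ 2).
  (* The distance is [expR (- (N * N))] minus a positive term. *)
  suff : expR (- (N * N)) < e by lra.
  rewrite expRN -[e]invrK ltf_pV2 ?posrE ?expR_gt0 ?invr_gt0//.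
  apply: lt_le_trans (expR_ge1Dx _); rewrite /N in N1 *; nra.
move=> [s t] [/=]; rewrite !ballEmdist.
move=> /(exp_ball_bounds _ _ N1) /andP[s1 s2].
move=> /(exp_ball_bounds _ _ N1) /andP[t1 t2].
rewrite /mulmap /=; nra.
Qed.

Theorem proposition3p4 (R : realType) :
  exists d : metric R R,
    [/\ compatible d, open_map (mulmap d) & ~ uniformly_open (mulmap d)].
Proof.
exists exp_metric; split.
- exact: compatible_exp_metric.
- exact/open_map_mulmap/compatible_exp_metric.
- exact: not_uniformly_open_exp_metric.
Qed.
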